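(* Let $F:S^1\to\mathbb{C}$ be continuous with Fourier coefficients $c_m(F):=\frac{1}{2\pi}\int_0^{2\pi}e^{-imx}F(e^{ix})\,dx$, $m\in\mathbb{Z}$, and assume $c_0(F)=0$. Let $(z_j)_{j\ge1}$ be i.i.d. $S^1$-valued random variables and let $\vartheta\ge0$. (i) If for some $\delta\in(0,1]$ one has $c_m(F)=O(|m|^{-1-\delta})$ as $|m|\to\infty$, then $\mathbb{E}[|\Delta_k(F,Z_{k,1})|]=O(k^{-1-\delta})$ as $k\to\infty$. (ii) If there exists $s>(1-\vartheta)_+$ such that $\sum_{m\in\mathbb{Z}}|m|^s|c_m(F)|<\infty$, then $$\sum_{k=1}^\infty k^{(1-\vartheta)_+}\,\mathbb{E}[|\Delta_k(F,Z_{k,1})|]<\infty .$$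
   Context: $S^1$ is the complex unit circle; $x_+=\max(x,0)$. For $k\ge1$ and $y\in S^1$, $\Delta_k(F,y):=\frac1k\sum_{\omega^k=y}F(\omega)$. $Z_{k,1}$ is a random variable equal in law to $\prod_{j=1}^kz_j$. *)

(* Defs.v *)
From HB Require Import structures.
From mathcomp Require Import all_boot all_order all_algebra.
From mathcomp Require Import finmap.
From mathcomp Require Import all_classical all_reals all_analysis.
From mathcomp Require Export complex.

Set Implicit Arguments.
Unset Strict Implicit.
Unset Printing Implicit Defensive.

Import Order.TTheory GRing.Theory Num.Theory.
Import numFieldNormedType.Exports.

Local Open Scope classical_set_scope.
Local Open Scope complex_scope.
Local Open Scope ring_scope.

(* The usual topology of the complex plane: the one given by the modulus. *)
HB.instance Definition _ (R : rcfType) :=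
  NormedModule.copy (complex R) (complex R)^o.

(* The real-valued modulus; the generic norm `|z| takes its values in R[i]. *)
Notation modulus := (@Normc.normc _).

Definition circle (R : realType) : Type :=
  set_type [set z : R[i] | `|z| = 1].

HB.instance Definition _ (R : realType) := SubChoice.on (circle R).
HB.instance Definition _ (R : realType) := Topological.on (circle R).

Section circle.
Context {R : realType}.
Implicit Types (x : R) (y z : circle R).

Definition cval (z : circle R) : R[i] := set_val z.

Lemma norm_cval z : `|cval z| = 1.
Proof. exact: (set_mem (valP z)). Qed.

Definition mk_circle (z : R[i]) (z1 : `|z| = 1) : circle R :=
  exist _ z (mem_set z1).

Definition circle_one : circle R := mk_circle (normr1 R[i]).

HB.instance Definition _ := isPointed.Build (circle R) circle_one.

Lemma norm_circle_mul y z : `|cval y * cval z| = 1.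
Proof. by rewrite normrM !norm_cval mulr1. Qed.

Definition circle_mul y z : circle R := mk_circle (norm_circle_mul y z).

Lemma norm_circle_exp x : `|cos x +i* sin x| = 1 :> R[i].
Proof. by rewrite normc_def /= cos2Dsin2 sqrtr1. Qed.

Definition circle_exp x : circle R := mk_circle (norm_circle_exp x).

Lemma cval_inj : injective cval.
Proof. exact: val_inj. Qed.

Lemma circle_mulA : associative circle_mul.
Proof. by move=> x y z; apply: cval_inj; exact: mulrA. Qed.

Lemma circle_mulC : commutative circle_mul.
Proof. by move=> x y; apply: cval_inj; exact: mulrC. Qed.

Lemma circle_mul1 : left_id circle_one circle_mul.
Proof. by move=> x; apply: cval_inj; exact: mul1r. Qed.

HB.instance Definition _ := Monoid.isComLaw.Build (circle R) circle_one
  circle_mul circle_mulA circle_mulC circle_mul1.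

End circle.

(* The circle carries its Borel sigma-algebra. *)
HB.instance Definition _ (R : realType) :=
  Measurable.copy (circle R) (g_sigma_algebraType (@open (circle R))).

Section fourier.
Context {R : realType}.
Implicit Types (F : circle R -> R[i]).

Definition complex_integral (D : set R) (f : R -> R[i]) : R[i] :=
  (\int[@lebesgue_measure R]_(x in D) complex.Re (f x))
  +i* (\int[@lebesgue_measure R]_(x in D) complex.Im (f x)).

Definition fourier_coef F (m : int) : R[i] :=
  ((2 * pi)^-1)%:C *
  complex_integral `[0, 2 * pi]
    (fun x => cval (circle_exp (- (m%:~R * x))) * F (circle_exp x)).

Definition Delta (k : nat) F (y : circle R) : R[i] :=
  k%:R^-1 * \sum_(w \in [set w : circle R | cval w ^+ k = cval y]) F w.

End fourier.

Section laws.
Context {R : realType} {d dE : measure_display} {T : measurableType d}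
  {E : measurableType dE}.

Definition eq_in_law {d' : measure_display} {T' : measurableType d'}
    (P : probability T R) (P' : probability T' R)
    (X : T -> E) (X' : T' -> E) : Prop :=
  forall A : set E, measurable A -> pushforward P X A = pushforward P' X' A.

Definition mutually_independent (P : probability T R) (X : nat -> T -> E) :
    Prop :=
  forall (J : {fset nat}) (A : nat -> set E),
    (forall j, j \in J -> measurable (A j)) ->
    P (\bigcap_(j in [set` J]) (X j @^-1` A j)) =
    (\prod_(j <- J) P (X j @^-1` A j))%E.

End laws.

Definition iid {R : realType} {d dE : measure_display} {T : measurableType d}
    {E : measurableType dE} (P : probability T R) (X : nat -> T -> E) : Prop :=
  mutually_independent P X /\ forall i j, eq_in_law P P (X i) (X j).

(* Main.v *)
Require Import Defs.
From HB Require Import structures.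
From mathcomp Require Import all_boot all_order all_algebra.
From mathcomp Require Import all_classical all_reals all_analysis.
From mathcomp Require Import cyclic separable cyclotomic.
From mathcomp Require Import measurable_realfun ring lra.

Set Implicit Arguments.
Unset Strict Implicit.
Unset Printing Implicit Defensive.

Import Order.TTheory GRing.Theory Num.Theory.
Import numFieldNormedType.Exports.

Local Open Scope classical_set_scope.
Local Open Scope ring_scope.

(** The averages [Delta k F] are small uniformly on the circle, and an
    expectation is at most any constant that dominates the random variable. If
    the Fourier series of [F] converges absolutely, then averaging it over the
    [k]-th roots of [y] kills every frequency that [k] does not divide, so that
      Delta k F y = sum over n in Z of c_(kn) y^n,
    and hence the modulus of [Delta k F y] is at most
      aliased_sum F k = sum over the multiples m of k of |c_m|.

    This inequality ([Delta_le]) holds for every continuous [F], with a possibly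
    infinite right-hand side. It is proved through the Fejer means of [F], which
    converge pointwise to [F] ([fejer_cvg]), and for which it is a finite
    computation ([Delta_fejer_le]): the n-th mean averages n rows, and row j
    only involves the coefficients c_(j-l), which are pairwise distinct terms of
    the series. Convergence of the Fejer means follows Korovkin: the kernel is
    nonnegative, has mean value one, and integrates [|e^(ix) - w|^2] to O(1/n),
    while [|F(e^(ix)) - F(w)|] lies below [e + K |e^(ix) - w|^2].

    Thus E |Delta k F Z| <= aliased_sum F k, and two estimates of series remain.
    For (i), c_m = O(|m|^(-1-delta)) and m = kn give k^(-1-delta) times the
    convergent sum of the |n|^(-1-delta) with n nonzero
    ([aliased_sum_powR]). For (ii), exchanging the sums over k and m gives, with
    a = (1-theta)_+,
      sum over m of |c_m| (sum over the divisors k of m of k^a),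
    where the inner sum is at most |m|^a d(|m|), and the number of divisors is
    d(n) = O(n^eps) for every eps > 0 ([divisor_bound]); with eps = s - a this
    is O(sum over m of |m|^s |c_m|) ([weighted_aliased_sum_lty]). *)

(** * The number of divisors *)

Lemma size_divisors_coprime (p a m : nat) : prime p -> (0 < m)%N ->
  coprime p m ->
  (size (divisors (p ^ a * m)) <= a.+1 * size (divisors m))%N.
Proof.
move=> pp m0 cpm.
have n0 : (0 < p ^ a * m)%N by rewrite muln_gt0 expn_gt0 prime_gt0.
pose s := [seq (p ^ i * e)%N | i <- iota 0 a.+1, e <- divisors m].
have -> : (a.+1 * size (divisors m) = size s)%N.
  by rewrite size_allpairs size_iota.
apply: uniq_leq_size; first exact: divisors_uniq.
move=> d; rewrite -dvdn_divisors// => dn.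
have d0 : (0 < d)%N := dvdn_gt0 n0 dn.
have [e cpe dE] := pfactor_coprime pp d0.
apply/allpairsP; exists (logn p d, e); split; last by rewrite /= mulnC.

- rewrite mem_iota leq0n add0n ltnS /= -(dvdn_Pexp2l _ _ (prime_gt1 pp)).
  rewrite -(@Gauss_dvdl _ _ m) ?coprimeXl//.
  by apply: dvdn_trans dn; exact: pfactor_dvdnn.
- rewrite /= -dvdn_divisors// -(@Gauss_dvdr _ (p ^ a)); last first.
    by rewrite coprime_sym coprimeXl.
  by apply: dvdn_trans dn; rewrite dE dvdn_mulr.
Qed.

Lemma bernoulli_le (R : realType) (x : R) (n : nat) :
  0 <= x -> 1 + n%:R * x <= (1 + x) ^+ n.
Proof.
move=> x0; elim: n => [|n ih]; first by rewrite mul0r addr0 expr0.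
rewrite exprS -natr1; apply: (@le_trans _ _ ((1 + x) * (1 + n%:R * x))).
  have : 0 <= n%:R * x * x :> R by rewrite !mulr_ge0.
  by lra.
by rewrite ler_wpM2l// addr_ge0.
Qed.

(** Writing n as the product of its prime powers p^a, the quotient
    [d(n) / n^eps] is the product of the factors [(a + 1) / (p^eps)^a]. By
    Bernoulli's inequality such a factor is at most 1 as soon as [p^eps >= 2],
    and at most [C = 1 + 1 / (2^eps - 1)] in any case, so that only the
    finitely many primes below [2^(1/eps)] contribute to the constant. *)
Lemma divisor_bound (R : realType) (eps : R) : 0 < eps ->
  exists2 D : R, 0 <= D &
    forall n : nat, (0 < n)%N -> (size (divisors n))%:R <= D * n%:R `^ eps.
Proof.
move=> eps0.
pose eta := 2 `^ eps - 1 : R.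
have eta0 : 0 < eta.
  rewrite subr_gt0 -[ltLHS](powRr0 2) /powR.
  by rewrite pnatr_eq0/= ltr_expR mul0r mulr_gt0// ln_gt0// ltr1n.
pose C := 1 + eta^-1.
have [N0 N0_gt] : exists N0 : nat, 2 `^ eps^-1 < N0%:R :> R.
  by exists (Num.truncn (2 `^ eps^-1 : R)).+1; exact: truncnS_gt.
have C1 : 1 <= C by rewrite lerDl invr_ge0 ltW.
have C0 : 0 <= C by rewrite (le_trans ler01).
have natX_powR (p a : nat) : (p ^ a)%:R `^ eps = (p%:R `^ eps) ^+ a :> R.
  by rewrite natrX -powR_mulrn// powRAC powR_mulrn// powR_ge0.
have small (p a : nat) : (2 <= p)%N -> a.+1%:R <= C * (p ^ a)%:R `^ eps.
  move=> p2.
  have h : 1 + a%:R * eta <= (p ^ a)%:R `^ eps.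
    apply: (le_trans (bernoulli_le a (ltW eta0))).
    rewrite /eta addrC subrK natX_powR lerXn2r ?nnegrE ?powR_ge0//.
    by rewrite ge0_ler_powR ?nnegrE ?ler_nat// ltW.
  apply: (le_trans _ (ler_wpM2l C0 h)).
  have -> : C * (1 + a%:R * eta) = a.+1%:R + (eta^-1 + a%:R * eta).
    by rewrite /C -natr1; field; rewrite gt_eqF.
  by rewrite lerDl addr_ge0 ?invr_ge0 ?mulr_ge0// ltW.
have large (p a : nat) : (N0 <= p)%N -> a.+1%:R <= (p ^ a)%:R `^ eps.
  move=> Np.
  have p2 : 2 <= p%:R `^ eps :> R.
    have -> : 2 = (2 `^ eps^-1) `^ eps :> R.
      by rewrite -powRrM mulVf ?gt_eqF// powRr1.
    rewrite ge0_ler_powR ?nnegrE ?powR_ge0 ?(ltW eps0)// ltW//.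
    by apply: (lt_le_trans N0_gt); rewrite ler_nat.
  rewrite natX_powR; apply: (@le_trans _ _ (2 ^+ a)).
    have := bernoulli_le a (@ler01 R).
    by rewrite mulr1 nat1r.
  by rewrite lerXn2r ?nnegrE ?powR_ge0.
suff H (N n : nat) : (0 < n)%N -> (forall p, prime p -> p %| n -> p < N)%N ->
    (size (divisors n))%:R <= C ^+ (minn N N0) * n%:R `^ eps.
  exists (C ^+ N0); first exact: exprn_ge0.
  move=> n n0; apply: (le_trans (H n.+1 n n0 _)).
    by move=> p _ /(dvdn_leq n0).
  by rewrite ler_wpM2r ?powR_ge0// ler_weXn2l// geq_minr.
(* Induction on a strict bound N of the prime factors: only N itself is split
   off at each step. *)
elim: N n => [|N ih] n n0 hn.
  have -> : n = 1%N.
    apply/eqP; rewrite eqn_leq n0 andbT leqNgt; apply/negP => /pdiv_prime/hn.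
    by rewrite pdiv_dvd => /(_ isT).
  by rewrite min0n expr0 mul1r powR1.
have Cmin : C ^+ minn N N0 <= C ^+ minn N.+1 N0.
  by rewrite ler_weXn2l// leq_min geq_minr andbT (leq_trans (geq_minl _ _)).
have [pN|npN] := boolP (prime N); last first.
  apply: (@le_trans _ _ (C ^+ minn N N0 * n%:R `^ eps)).
    apply: ih => // p pp pn; rewrite ltn_neqAle -ltnS hn// andbT.
    by apply: contra npN => /eqP <-.
  by rewrite ler_wpM2r// powR_ge0.
have [m cm nE] := pfactor_coprime pN n0.
set a := logn N n in nE.
have m0 : (0 < m)%N by move: n0; rewrite nE muln_gt0 => /andP[].
rewrite nE mulnC.
have := size_divisors_coprime a pN m0 cm.
rewrite -(ler_nat R) => /le_trans; apply.
rewrite !natrM powRM//.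
have ihm : (size (divisors m))%:R <= C ^+ minn N N0 * m%:R `^ eps.
  apply: ih => // p pp pm; rewrite ltn_neqAle -ltnS hn ?andbT//; last first.
    by rewrite nE dvdn_mulr.
  apply: contraTneq cm => <-; rewrite prime_coprime// pm//.
rewrite (mulrC a.+1%:R).
have [NN0|NN0] := ltnP N N0.
- have -> : C ^+ minn N.+1 N0 = C ^+ minn N N0 * C.
    by rewrite (minn_idPl NN0) (minn_idPl (ltnW NN0)) exprSr.
  apply: le_trans (ler_pM _ _ ihm (small _ a (prime_gt1 pN))) _ => //.
  by rewrite -!mulrA (mulrCA (m%:R `^ eps)) (mulrC (m%:R `^ eps)).
- apply: le_trans (ler_pM _ _ ihm (large _ a NN0)) _ => //.
  rewrite (minn_idPr NN0) (minn_idPr (leqW NN0)).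
  by rewrite -mulrA (mulrC (m%:R `^ eps)).
Qed.

(** * Sums of powers and unordered sums *)

(** Derived from [ln x <= ln (x + 1) - 1 / (x + 1)]; it makes the sum of the
    [n^(-1-d)] telescope. *)
Lemma powR_telescope (R : realType) (d x : R) : 0 <= d -> 0 < x ->
  d * (x + 1) `^ (- 1 - d) <= x `^ (- d) - (x + 1) `^ (- d).
Proof.
move=> d0 x0; have x10 : 0 < x + 1 by rewrite addr_gt0.
have lnx : ln x <= ln (x + 1) - (x + 1)^-1.
  have := @le_ln1Dx R (- (x + 1)^-1); rewrite ltrN2 invf_lt1// ltrDr x0.
  move=> /(_ isT); have -> : 1 + - (x + 1)^-1 = x / (x + 1).
    by field; rewrite gt_eqF.
  by rewrite ln_div ?posrE// lerBlDl.
have -> : (x + 1) `^ (- 1 - d) = (x + 1) `^ (- d) * (x + 1)^-1.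
  by rewrite (addrC (- 1)) powRD ?(lt0r_neq0 x10) ?implybT// powR_inv1// ltW.
rewrite lerBrDr; apply: (@le_trans _ _ ((x + 1) `^ (- d) * expR (d / (x + 1)))).
  rewrite [leLHS](_ : _ = (x + 1) `^ (- d) * (1 + d / (x + 1))); last by ring.
  by rewrite ler_wpM2l ?powR_ge0// expR_ge1Dx.
rewrite /powR !gt_eqF// -expRD ler_expR.
have := ler_wpM2l d0 lnx; lra.
Qed.

Lemma sum_powR_le (R : realType) (d : R) (n : nat) : 0 < d ->
  \sum_(0 <= i < n) i%:R `^ (- 1 - d) <= 1 + d^-1.
Proof.
move=> d0; have dV0 : 0 <= d^-1 by rewrite invr_ge0 ltW.
case: n => [|n]; first by rewrite big_nil addr_ge0.
rewrite big_nat_recl// powR0 ?add0r; last by rewrite lt_eqF//; lra.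
case: n => [|n]; first by rewrite big_nil addr_ge0.
suff : \sum_(0 <= i < n.+1) i.+1%:R `^ (- 1 - d) <=
    1 + d^-1 - d^-1 * n.+1%:R `^ (- d).
  by move/le_trans; apply; rewrite lerBlDr lerDl mulr_ge0 ?powR_ge0.
elim: n => [|n ih]; first by rewrite big_nat1 !powR1 mulr1 addrK.
rewrite big_nat_recr//=.
have := powR_telescope (ltW d0) (ltr0Sn R n); rewrite natr1.
move=> /(ler_wpM2l dV0); rewrite mulrA mulVf ?gt_eqF// mul1r.
by move: ih; lra.
Qed.

Lemma esum_nat_le (R : realType) (f : nat -> R) (M : R) :
  (forall n, 0 <= f n) -> (forall n, \sum_(0 <= i < n) f i <= M) ->
  (\esum_(n in [set: nat]) (f n)%:E <= M%:E)%E.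
Proof.
move=> f0 fM; rewrite -nneseries_esumT; last by move=> n; rewrite lee_fin.
apply: lime_le; first by apply: is_cvg_nneseries => n _ _; rewrite lee_fin.
by near=> n; rewrite sumEFin lee_fin.
Unshelve. all: by end_near. Qed.

(** The index 0 contributes nothing, as 0 to a nonzero exponent is 0. *)
Lemma esum_int_powR_le (R : realType) (d : R) : 0 < d ->
  exists2 M : R, 0 <= M &
    (\esum_(m in [set: int]) (`|m|%N%:R `^ (- 1 - d))%:E <= M%:E)%E.
Proof.
move=> d0; exists ((1 + d^-1) + (1 + d^-1)).
  by rewrite !addr_ge0// invr_ge0 ltW.
rewrite (esumID (range Posz)); last by move=> m _; rewrite lee_fin powR_ge0.
rewrite EFinD setTI setTI leeD//.
  rewrite esum_image; last by move=> i j _ _ [].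
  apply: esum_nat_le => [n|n]; first exact: powR_ge0.
  exact: sum_powR_le.
have -> : ~` (range Posz) = range Negz.
  apply/seteqP; split => [[n|n]|_ [n _ <-] [m _]]//=.
    by case; exists n.
  by move=> _; exists n.
rewrite esum_image; last by move=> i j _ _ [].
apply: esum_nat_le => [n|n]; first exact: powR_ge0.
apply: le_trans (sum_powR_le n.+1 d0).
by rewrite big_nat_recl// lerDr powR_ge0.
Qed.

Lemma le_esumZl (R : realType) (I : choiceType) (S : set I) (c : R)
    (a : I -> \bar R) : 0 <= c -> (forall i, 0 <= a i)%E ->
  (\esum_(i in S) (c%:E * a i) <= c%:E * \esum_(i in S) a i)%E.
Proof.
move=> c0 a0; apply: ge_ereal_sup => _ [X [Xfin XS] <-].
rewrite fsbig_finite//= -ge0_sume_distrr//.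
by rewrite lee_wpmul2l ?lee_fin// -fsbig_finite//; apply: esum_ge; exists X.
Qed.

Lemma esumZl (R : realType) (I : choiceType) (S : set I) (c : R)
    (a : I -> \bar R) : 0 <= c -> (forall i, 0 <= a i)%E ->
  (\esum_(i in S) (c%:E * a i) = c%:E * \esum_(i in S) a i)%E.
Proof.
move=> c0 a0; apply/eqP; rewrite eq_le le_esumZl//=.
have [->|c_neq0] := eqVneq c 0.
  by rewrite mul0e esum_ge0// => i _; rewrite mul0e.
have ca0 i : (0 <= c%:E * a i)%E by rewrite mule_ge0.
have cV0 : 0 <= c^-1 by rewrite invr_ge0.
have := lee_wpmul2l (_ : (0 <= c%:E)%E) (le_esumZl S cV0 ca0).
rewrite lee_fin muleA -EFinM mulfV// mul1e => /(_ c0).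
apply: le_trans; rewrite lee_wpmul2l// le_esum// => i _.
by rewrite muleA -EFinM mulVf// mul1e.
Qed.

Lemma sum_le_esum (R : realType) (I : finType) (J : choiceType) (P : pred I)
    (S : set J) (e : I -> J) (a : J -> \bar R) :
  (forall j, 0 <= a j)%E -> {in P &, injective e} ->
  (forall i, P i -> S (e i)) ->
  (\sum_(i | P i) a (e i) <= \esum_(j in S) a j)%E.
Proof.
move=> a0 inje PS; pose X := e @` [set i | P i].
have Xfin : finite_set X by exact: finite_image.
apply: esum_ge; exists X; first by split => // _ [i Pi <-]; exact: PS.
rewrite -esum_fset// esum_image; last first.
  by move=> i j /set_mem/= Pi /set_mem/= Pj; exact: inje.
rewrite esum_fset//; last exact: finite_finset.
rewrite fsbig_finite/=; last exact: finite_finset.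
rewrite [leRHS](perm_big [seq i <- index_enum I | P i]); last first.
  apply: uniq_perm; rewrite ?filter_uniq ?index_enum_uniq ?finmap.fset_uniq//.
  move=> i; rewrite in_fset_set; last exact: finite_finset.
  rewrite mem_filter mem_index_enum andbT.
  by apply/idP/idP; rewrite inE.
by rewrite big_filter.
Qed.

(** * Roots on the circle *)

Lemma exists_prim_root (C : numClosedFieldType) (n : nat) : (0 < n)%N ->
  exists z : C, n.-primitive_root z.
Proof.
move=> n0; pose p : {poly C} := 'X^n - 1.
have [r Dp] := closed_field_poly_normal p.
rewrite (monicP _) ?monicXnsubC // scale1r in Dp.
have rn1: all n.-unity_root r.
  by apply/allP=> z; rewrite -root_prod_XsubC -Dp.
have sz_r: (n < (size r).+1)%N.
  by rewrite -(size_prod_XsubC r id) -Dp size_XnsubC.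
have [|z] := hasP (has_prim_root n0 rn1 _ sz_r); last by exists z.
by rewrite -separable_prod_XsubC -Dp separable_Xn_sub_1 // pnatr_eq0 -lt0n.
Qed.

Lemma prim_root_expz_eq1 (C : numClosedFieldType) (n : nat) (z : C) (m : int) :
  n.-primitive_root z -> (z ^ m == 1) = (n %| m)%Z.
Proof.
move=> pz; rewrite dvdzE absz_nat (prim_order_dvd pz).
case: m => m; first by rewrite -exprnP.
by rewrite NegzE -exprnN invr_eq1 abszN.
Qed.

Section modulus.
Context {R : realType}.
Implicit Types x y : R[i].

Lemma normr_modulus x : `|x| = ((modulus x)%:C)%C.
Proof. by []. Qed.

Lemma modulus_ge0 x : 0 <= modulus x.
Proof. by rewrite -ler0c -normr_modulus. Qed.

Lemma modulusD x y : modulus (x + y) <= modulus x + modulus y.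
Proof. exact: le_normcD. Qed.

Lemma modulus_sum (I : Type) (s : seq I) (P : pred I) (f : I -> R[i]) :
  modulus (\sum_(i <- s | P i) f i) <= \sum_(i <- s | P i) modulus (f i).
Proof.
apply: (big_ind2 (fun u v => modulus u <= v)) => [|x1 x2 y1 y2 h1 h2|//].
  by rewrite Normc.normc0.
exact: le_trans (modulusD _ _) (lerD h1 h2).
Qed.

Lemma modulus_natV (n : nat) : modulus (n%:R^-1 : R[i]) = n%:R^-1.
Proof.
apply: complexI; rewrite -normr_modulus normfV normr_nat.
by rewrite fmorphV rmorph_nat.
Qed.

End modulus.

Section circle_roots.
Context {R : realType}.
Implicit Types y w : circle R.

Lemma cval_neq0 w : cval w != 0.
Proof. by rewrite -normr_gt0 norm_cval ltr01. Qed.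

Lemma modulus_cvalX w (m : int) : modulus (cval w ^ m) = 1.
Proof.
apply: complexI; rewrite -normr_modulus.
case: m => m; first by rewrite -exprnP normrX norm_cval expr1n.
by rewrite NegzE -exprnN normfV normrX norm_cval expr1n invr1.
Qed.

Lemma modulus_cval w : modulus (cval w) = 1.
Proof. exact: (modulus_cvalX w 1). Qed.

(** A sum over an infinite set is 0 by convention, so this finiteness is what
    makes [Delta] an honest average. *)
Lemma finite_circle_roots (k : nat) y : (0 < k)%N ->
  finite_set [set w : circle R | cval w ^+ k = cval y].
Proof.
move=> k0; pose p : {poly R[i]} := 'X^k - (cval y)%:P.
have [r Dp] := closed_field_poly_normal p.
have -> : [set w : circle R | cval w ^+ k = cval y] = cval @^-1` [set` r].
  rewrite (monicP _) ?monicXnsubC // scale1r in Dp.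
  apply/seteqP; split => w /=.
    by move=> wy; rewrite -root_prod_XsubC -Dp rootE !hornerE wy subrr.
  by rewrite -root_prod_XsubC -Dp rootE !hornerE subr_eq0 => /eqP.
apply: finite_preimage; last exact: finite_seq.
by move=> ? ? _ _; exact: cval_inj.
Qed.

Lemma circle_rootsP (k : nat) y : (0 < k)%N -> exists s : seq (circle R),
  [/\ uniq s, (size s <= k)%N,
      forall w, (w \in s) = (cval w ^+ k == cval y) &
      forall F, Delta k F y = k%:R^-1 * \sum_(w <- s) F w].
Proof.
move=> k0; have Afin := finite_circle_roots y k0.
set A := [set w | _] in Afin.
pose s := finmap.enum_fset (fset_set A).
have us : uniq s by exact: finmap.fset_uniq.
have sE w : (w \in s) = (cval w ^+ k == cval y).
  rewrite /s (in_fset_set Afin); apply/idP/eqP; first by rewrite inE.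
  by move=> h; rewrite inE.
exists s; split => //; last by move=> F; rewrite /Delta fsbig_finite.
have p0 : 'X^k - (cval y)%:P != 0 :> {poly R[i]}.
  by rewrite -size_poly_gt0 size_XnsubC.
have := @max_poly_roots _ _ [seq cval w | w <- s] p0.
rewrite size_XnsubC// ltnS size_map; apply.
  apply/allP => _ /mapP[w + ->]; rewrite sE rootE !hornerE subr_eq0//.
by rewrite map_inj_uniq//; exact: cval_inj.
Qed.

(** The [k]-th roots of [y] are permuted by multiplication by a primitive [k]-th
    root of unity, which multiplies the sum of their [m]-th powers by a number
    other than 1 unless [k] divides [m]. *)
Lemma sum_circle_roots_eq0 (k : nat) y (s : seq (circle R)) (m : int) :
  (0 < k)%N -> uniq s -> (forall w, (w \in s) = (cval w ^+ k == cval y)) ->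
  ~~ (k %| m)%Z -> \sum_(w <- s) cval w ^ m = 0.
Proof.
move=> k0 us sE km; have [z pz] := exists_prim_root R[i] k0.
have z1 : `|z| = 1.
  by apply/eqP; rewrite -(pexpr_eq1 k0)// -normrX (prim_expr_order pz) normr1.
have permz : perm_eq [seq circle_mul (mk_circle z1) w | w <- s] s.
  have uz : uniq [seq circle_mul (mk_circle z1) w | w <- s].
    rewrite map_inj_uniq// => v w /(congr1 cval)/= h; apply: cval_inj.
    by apply: mulfI h; exact: (cval_neq0 (mk_circle z1)).
  apply: uniq_perm => //; apply: (uniq_min_size uz _ _).2; last first.
    by rewrite size_map.
  move=> _ /mapP[w + ->]; rewrite !sE => /eqP wy.
  rewrite [cval (circle_mul _ _)]/(z * cval w) exprMn.
  by rewrite (prim_expr_order pz) mul1r wy.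
have zm : z ^ m != 1 by rewrite (prim_root_expz_eq1 m pz).
have : \sum_(w <- s) cval w ^ m = z ^ m * \sum_(w <- s) cval w ^ m.
  rewrite -[LHS](perm_big _ permz) big_map mulr_sumr; apply: eq_bigr => w _.
  by rewrite [cval (circle_mul _ _)]/(z * cval w) expfzMl.
move/eqP; rewrite eq_sym -subr_eq0 -{2}[\sum_(w <- s) _]mul1r -mulrBl mulf_eq0.
by rewrite subr_eq0 (negbTE zm) => /eqP.
Qed.

End circle_roots.

(** * Fejer means and averages over roots *)

Section fejer.
Context {R : realType}.
Implicit Types (F : circle R -> R[i]) (w y : circle R).

(** The usual Cesaro mean, with weight [1 - |m| / n] on the frequency m, before
    the pairs (j, l) with the same difference m are collected. *)
Definition fejer F (n : nat) w : R[i] :=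
  n%:R^-1 * \sum_(j < n) \sum_(l < n)
    fourier_coef F (j%:Z - l%:Z) * cval w ^ (j%:Z - l%:Z).

(** For each row j the frequencies j - l are distinct, so the terms that survive
    the averaging over the roots form a part of the series on the right. *)
Lemma Delta_fejer_le F (n k : nat) y : (0 < k)%N ->
  ((modulus (Delta k (fejer F n) y))%:E <=
    \esum_(m in [set m : int | (k %| m)%Z]) (modulus (fourier_coef F m))%:E)%E.
Proof.
move=> k0; have [s [us sk sE ->]] := circle_rootsP y k0.
set S := (\esum_(m in _) _)%E.
have S0 : (0 <= S)%E by apply: esum_ge0 => m _; rewrite lee_fin modulus_ge0.
have [->|Sfin] := eqVneq S +oo%E; first exact: leey.
have SE : S = (fine S)%:E.
  by rewrite fineK// fin_numE Sfin gt_eqF// (lt_le_trans _ S0).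
rewrite SE lee_fin.
have row (j : 'I_n) : \sum_(l < n | (k %| j%:Z - l%:Z)%Z)
    modulus (fourier_coef F (j%:Z - l%:Z)) <= fine S.
  rewrite -lee_fin -SE -sumEFin.
  apply: (@sum_le_esum _ _ _ (fun l : 'I_n => (k %| j%:Z - l%:Z)%Z) _
    (fun l : 'I_n => j%:Z - l%:Z)
    (fun m => (modulus (fourier_coef F m))%:E)) => //.
    by move=> m; rewrite lee_fin modulus_ge0.
  by move=> l1 l2 _ _ /addrI/oppr_inj [] /val_inj.
have -> : k%:R^-1 * \sum_(w <- s) fejer F n w = n%:R^-1 *
    \sum_(j < n) \sum_(l < n | (k %| j%:Z - l%:Z)%Z)
      fourier_coef F (j%:Z - l%:Z) *
      (k%:R^-1 * \sum_(w <- s) cval w ^ (j%:Z - l%:Z)).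
  rewrite /fejer -mulr_sumr exchange_big/= mulrCA; congr (_ * _).
  rewrite mulr_sumr; apply: eq_bigr => j _.
  rewrite exchange_big/= mulr_sumr [RHS]big_mkcond; apply: eq_bigr => l _.
  rewrite -mulr_sumr mulrCA; case: ifPn => // kjl.
  by rewrite (sum_circle_roots_eq0 k0 us sE kjl) !mulr0.
rewrite Normc.normcM modulus_natV.
case: n row => [|n] row; first by rewrite invr0 mul0r fine_ge0.
rewrite ler_pdivrMl// mulr_natl -[n.+1 in leRHS]card_ord -sumr_const.
apply: (le_trans (modulus_sum _ _ _)); apply: ler_sum => j _.
apply: le_trans (row j).
apply: (le_trans (modulus_sum _ _ _)); apply: ler_sum => l _.
rewrite Normc.normcM ler_piMr ?modulus_ge0// Normc.normcM modulus_natV.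
rewrite ler_pdivrMl ?ltr0n// mulr1.
apply: (le_trans (modulus_sum _ _ _)).
under eq_bigr do rewrite modulus_cvalX.
by rewrite big_const_seq count_predT iter_addr_0 ler_nat.
Qed.

End fejer.

(** * Continuity and integration over a period *)

Section circle_topology.
Context {R : realType}.
Implicit Types (F : circle R -> R[i]) (w : circle R).

Lemma circle_continuousP F w (e : R) : {for w, continuous F} -> 0 < e ->
  exists2 d : R, 0 < d & forall v : circle R,
    modulus (cval v - cval w) < d -> modulus (F v - F w) < e.
Proof.
move=> Fc e0.
have eC0 : 0 < ((e%:C)%C : R[i]) by rewrite ltcR.
have /Fc : nbhs (F w) (ball (F w) ((e%:C)%C : R[i])) by exact: nbhsx_ballx.
rewrite nbhsE => -[B [[C Copen CB] Bw] BF].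
have : nbhs (cval w) C.
  apply: open_nbhs_nbhs; split => //.
  by rewrite -[C _]/((set_val @^-1` C) w) CB.
move=> /nbhs_ballP[[a b] ab0 abC].
move: ab0; rewrite /= ltcE/= => /andP[/eqP b0 a0]; rewrite b0 in abC.
exists a => // v vw.
have /BF : B v.
  rewrite -CB; apply: abC.
  by rewrite /ball/= -normrN opprB normr_modulus ltcR.
by rewrite /ball/= -normrN opprB normr_modulus ltcR.
Qed.
End circle_topology.

Section circle_exp_theory.
Context {R : realType}.
Implicit Types x y : R.

Local Notation ce x := (cval (circle_exp x)).

Lemma circle_expE x : ce x = Complex (cos x) (sin x).
Proof. by []. Qed.

Lemma circle_expD x y : ce (x + y) = ce x * ce y.
Proof. by rewrite !circle_expE sinD cosD; congr Complex; rewrite addrC. Qed.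

Lemma circle_exp0 : ce (0 : R) = 1.
Proof. by rewrite circle_expE sin0 cos0. Qed.

Lemma circle_exp2pi : ce (2 * pi : R) = 1.
Proof. by rewrite circle_expE mulr_natl cos2pi sin2pi. Qed.

Lemma circle_expN x : ce (- x) = (ce x)^-1.
Proof.
by apply: (mulfI (cval_neq0 (circle_exp x))); rewrite -circle_expD subrr
  circle_exp0 mulfV// cval_neq0.
Qed.

Lemma circle_exp_intM (m : int) x : ce (m%:~R * x) = ce x ^ m.
Proof.
have nat_case (n : nat) : ce (n%:R * x) = ce x ^+ n.
  elim: n => [|n ih]; first by rewrite mul0r circle_exp0 expr0.
  by rewrite -natr1 mulrDl mul1r circle_expD ih exprSr.
case: m => n; first by rewrite -pmulrn nat_case.
by rewrite NegzE mulrNz mulNr circle_expN -pmulrn nat_case exprnN.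
Qed.

End circle_exp_theory.

Section ccontinuous.
Context {R : realType}.
Implicit Types f g : R -> R[i].

(** Continuity of the two real components is the form in which the integrals
    of the real and imaginary parts use it. *)
Definition ccontinuous f :=
  continuous (fun x => complex.Re (f x)) /\
  continuous (fun x => complex.Im (f x)).

Lemma ccontinuous_cst (c : R[i]) : ccontinuous (fun=> c).
Proof. by split => x; exact: cvg_cst. Qed.

Lemma ccontinuousD f g :
  ccontinuous f -> ccontinuous g -> ccontinuous (fun x => f x + g x).
Proof.
move=> [fr fi] [gr gi]; split => x.
  rewrite (_ : (fun _ => _) =
    (fun x => complex.Re (f x)) \+ (fun x => complex.Re (g x))); last first.
    by apply/funext => t /=; case: (f t) (g t) => ? ? [].
  by apply: cvgD; [exact: fr|exact: gr].
rewrite (_ : (fun _ => _) =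
  (fun x => complex.Im (f x)) \+ (fun x => complex.Im (g x))); last first.
  by apply/funext => t /=; case: (f t) (g t) => ? ? [].
by apply: cvgD; [exact: fi|exact: gi].
Qed.

Lemma ccontinuousM f g :
  ccontinuous f -> ccontinuous g -> ccontinuous (fun x => f x * g x).
Proof.
move=> [fr fi] [gr gi]; split => x.
  rewrite (_ : (fun _ => _) = (fun x => complex.Re (f x) * complex.Re (g x) -
    complex.Im (f x) * complex.Im (g x))); last first.
    by apply/funext => t /=; case: (f t) (g t) => ? ? [].
  by apply: cvgB; apply: cvgM; [exact: fr|exact: gr|exact: fi|exact: gi].
rewrite (_ : (fun _ => _) = (fun x => complex.Re (f x) * complex.Im (g x) +
  complex.Im (f x) * complex.Re (g x))); last first.
  by apply/funext => t /=; case: (f t) (g t) => ? ? [].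
by apply: cvgD; apply: cvgM; [exact: fr|exact: gi|exact: fi|exact: gr].
Qed.

Lemma ccontinuous_sum (I : Type) (s : seq I) (F : I -> R -> R[i]) :
  (forall i, ccontinuous (F i)) -> ccontinuous (fun x => \sum_(i <- s) F i x).
Proof.
move=> Fc; elim: s => [|i s ih].
  under [X in ccontinuous X]funext do rewrite big_nil.
  exact: ccontinuous_cst.
under [X in ccontinuous X]funext do rewrite big_cons.
exact: ccontinuousD.
Qed.

Lemma ccontinuous_circle_exp (a : R) :
  ccontinuous (fun x => cval (circle_exp (a * x))).
Proof.
have mulc (x : R) : {for x, continuous (fun t : R => a * t)}.
  by apply: cvgM; [exact: cvg_cst|exact: cvg_id].
split => x.
  apply: (@continuous_comp _ _ _ (fun t => a * t) cos); first exact: mulc.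
  exact: continuous_cos.
apply: (@continuous_comp _ _ _ (fun t => a * t) sin); first exact: mulc.
exact: continuous_sin.
Qed.

Lemma le_modulus_Re (z : R[i]) : `|complex.Re z| <= modulus z.
Proof. by have := normc_ge_Re z; rewrite normr_modulus lecR. Qed.

Lemma le_modulus_Im (z : R[i]) : `|complex.Im z| <= modulus z.
Proof.
by case: z => a b /=; rewrite -sqrtr_sqr ler_wsqrtr// lerDr sqr_ge0.
Qed.

Lemma modulus_le_ReIm (z : R[i]) :
  modulus z <= `|complex.Re z| + `|complex.Im z|.
Proof.
case: z => a b /=; rewrite -[leRHS]ger0_norm ?addr_ge0// -sqrtr_sqr.
rewrite ler_wsqrtr// sqrrD !real_normK ?num_real// lerD2r lerDl.
by rewrite mulrn_wge0// mulr_ge0.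
Qed.

Lemma ccontinuous_comp_circle_exp (F : circle R -> R[i]) :
  continuous F -> ccontinuous (F \o circle_exp).
Proof.
move=> Fc.
have H (x e : R) : 0 < e ->
    \forall t \near x, modulus (F (circle_exp t) - F (circle_exp x)) < e.
  move=> e0; have [d d0 Fd] := circle_continuousP (Fc (circle_exp x)) e0.
  have d20 : 0 < d / 2 by rewrite divr_gt0.
  have /cvgrPdist_lt/(_ _ d20) cosx := @continuous_cos R x.
  have /cvgrPdist_lt/(_ _ d20) sinx := @continuous_sin R x.
  near=> t; apply: Fd; apply: (le_lt_trans (modulus_le_ReIm _)).
  rewrite [ltRHS]splitr ltrD//= distrC.
    by near: t; exact: cosx.
  by near: t; exact: sinx.
split => x; apply/cvgrPdist_lt => e e0; have := H x e e0.
  apply: filterS => t; apply: le_lt_trans; rewrite distrC.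
  apply: le_trans (le_modulus_Re _).
  by rewrite /=; case: (F (circle_exp t)) (F (circle_exp x)) => ? ? [].
apply: filterS => t; apply: le_lt_trans; rewrite distrC.
apply: le_trans (le_modulus_Im _).
by rewrite /=; case: (F (circle_exp t)) (F (circle_exp x)) => ? ? [].
Unshelve. all: by end_near. Qed.

End ccontinuous.

Section period_integral.
Context {R : realType}.
Implicit Types (f g : R -> R[i]) (u v : R -> R).

Local Notation period := (`[0, 2 * pi]%classic : set R).
Local Notation mu := (@lebesgue_measure R).

Lemma period_integrable u : continuous u -> mu.-integrable period (EFin \o u).
Proof.
move=> uc; apply: continuous_compact_integrable; first exact: segment_compact.
exact: continuous_subspaceT.
Qed.

Lemma complex_integralD f g : ccontinuous f -> ccontinuous g ->
  complex_integral period (fun x => f x + g x) =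
  complex_integral period f + complex_integral period g.
Proof.
move=> [fr fi] [gr gi]; rewrite /complex_integral.
under eq_Rintegral => x _.
  rewrite (_ : complex.Re _ =
    complex.Re (f x) + complex.Re (g x)); last by case: (f x) (g x) => ? ? [].
  over.
under [X in Complex _ X]eq_Rintegral => x _.
  rewrite (_ : complex.Im _ =
    complex.Im (f x) + complex.Im (g x)); last by case: (f x) (g x) => ? ? [].
  over.
by rewrite !RintegralD//; exact: period_integrable.
Qed.

Lemma complex_integralZl (c : R[i]) f : ccontinuous f ->
  complex_integral period (fun x => c * f x) = c * complex_integral period f.
Proof.
move=> [fr fi]; rewrite /complex_integral.
have intr := period_integrable fr; have inti := period_integrable fi.
have Zc (u : R -> R) (a : R) : continuous u ->
    mu.-integrable period (EFin \o (fun x => a * u x)).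
  move=> uc; apply: period_integrable => x.
  by apply: cvgM; [exact: cvg_cst|exact: uc].
case: c => a b.
under eq_Rintegral => x _.
  rewrite (_ : complex.Re _ =
    a * complex.Re (f x) - b * complex.Im (f x)); last by case: (f x).
  over.
under [X in Complex _ X]eq_Rintegral => x _.
  rewrite (_ : complex.Im _ =
    a * complex.Im (f x) + b * complex.Re (f x)); last by case: (f x).
  over.
rewrite RintegralB//; [|exact: Zc..].
rewrite RintegralD//; [|exact: Zc..].
by rewrite !RintegralZl.
Qed.

Lemma complex_integral_sum (I : Type) (s : seq I) (F : I -> R -> R[i]) :
  (forall i, ccontinuous (F i)) ->
  complex_integral period (fun x => \sum_(i <- s) F i x) =
  \sum_(i <- s) complex_integral period (F i).
Proof.
move=> Fc; elim: s => [|i s ih].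
  rewrite big_nil; under [X in complex_integral _ X]funext do rewrite big_nil.
  have := complex_integralZl 0 (ccontinuous_cst (1 : R[i])).
  by rewrite !mul0r.
rewrite big_cons -ih -complex_integralD//; last exact: ccontinuous_sum.
by under [X in complex_integral _ X]funext do rewrite big_cons.
Qed.

End period_integral.

(** * Convergence of the Fejer means *)

Section fejer_kernel.
Context {R : realType}.
Implicit Types (F : circle R -> R[i]) (w : circle R) (n : nat) (x a : R).

Local Notation ce x := (cval (circle_exp x)).
Local Notation period := (`[0, 2 * pi]%classic : set R).
Local Notation mu := (@lebesgue_measure R).
Local Notation J u := (Rintegral mu period u).

Lemma twopi_gt0 : 0 < 2 * pi :> R.
Proof. by rewrite mulr_gt0// pi_gt0. Qed.

Lemma period_measure : fine (mu period) = 2 * pi.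
Proof.
by rewrite lebesgue_measure_itv/= lte_fin twopi_gt0 oppr0 addr0.
Qed.

Lemma period_integral_derive (U u : R -> R) :
  (forall x, is_derive x 1 U (u x)) -> continuous u ->
  J u = U (2 * pi) - U 0.
Proof.
move=> dU uc; rewrite /Rintegral (@continuous_FTC2 _ _ U)//.
- exact: twopi_gt0.
- exact: continuous_subspaceT.
- have Uc : continuous U.
    move=> x; apply/differentiable_continuous/derivable1_diffP.
    exact: ex_derive.
  split; first by move=> x _; exact: ex_derive.
  + by apply: cvg_at_right_filter; exact: Uc.
  + by apply: cvg_at_left_filter; exact: Uc.
- by move=> x _; rewrite derive1E derive_val.
Qed.

Lemma fourier_coef1 (m : int) :
  fourier_coef (fun _ : circle R => 1) m = (m == 0)%:R.
Proof.
rewrite /fourier_coef /complex_integral.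
under [X in Complex X _]eq_Rintegral => x _ do rewrite mulr1 circle_expE/=.
under [X in Complex _ X]eq_Rintegral => x _ do rewrite mulr1 circle_expE/=.
have [->|m0] := eqVneq m 0.
  under [X in Complex X _]eq_Rintegral => x _ do rewrite mul0r oppr0 cos0.
  under [X in Complex _ X]eq_Rintegral => x _ do rewrite mul0r oppr0 sin0.
  rewrite !Rintegral_cst// mul1r mul0r period_measure.
  rewrite -[Complex _ 0]/((2 * pi)%:C)%C -rmorphM mulVf ?rmorph1//.
  by rewrite gt_eqF// twopi_gt0.
pose a : R := - m%:~R.
have a0 : a != 0 by rewrite oppr_eq0 intr_eq0.
have ce2pi : ce (a * (2 * pi)) = 1.
  by rewrite mulNr circle_expN circle_exp_intM circle_exp2pi exp1rz invr1.
have [ca sa] := ccontinuous_circle_exp a.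
have d (x : R) : is_derive x 1 ( *%R a) a.
  rewrite -[X in is_derive _ _ _ X]mulr1.
  exact: is_deriveZ.
under eq_Rintegral => x _ do rewrite -mulNr -/a.
under [X in Complex _ X]eq_Rintegral => x _ do rewrite -mulNr -/a.
have -> : J (fun x => cos (a * x)) = 0.
  rewrite (@period_integral_derive (fun x => a^-1 * sin (a * x)) _ _ ca).
    by case: ce2pi => _ ->; rewrite !mulr0 sin0 mulr0 subrr.
  move=> x; have := is_derive1_comp (is_derive_sin (a * x)) (d x).
  move=> /(is_deriveZ a^-1) h; apply: is_derive_eq h _.
  by rewrite circle_expE /GRing.scale/= mulrCA mulVf// mulr1.
have -> : J (fun x => sin (a * x)) = 0.
  rewrite (@period_integral_derive (fun x => - a^-1 * cos (a * x)) _ _ sa).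
    by case: ce2pi => -> _; rewrite mulr0 cos0 subrr.
  move=> x; have := is_derive1_comp (is_derive_cos (a * x)) (d x).
  move=> /(is_deriveZ (- a^-1)) h; apply: is_derive_eq h _.
  rewrite circle_expE /GRing.scale/=.
  by rewrite mulNr -mulrN mulNr opprK mulrCA mulVf// mulr1.
by rewrite mulr0.
Qed.

Lemma Re_realM a (z : R[i]) : complex.Re ((a%:C)%C * z) = a * complex.Re z.
Proof. by case: z => b c; rewrite /= mul0r subr0. Qed.

Lemma Im_realM a (z : R[i]) : complex.Im ((a%:C)%C * z) = a * complex.Im z.
Proof. by case: z => b c; rewrite /= mul0r addr0. Qed.

Lemma Re_complex_integral (f : R -> R[i]) :
  complex.Re (complex_integral period f) = J (fun x => complex.Re (f x)).
Proof. by []. Qed.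

Lemma Im_complex_integral (f : R -> R[i]) :
  complex.Im (complex_integral period f) = J (fun x => complex.Im (f x)).
Proof. by []. Qed.

(** The Fejer kernel centred at [w], not divided by [2 * pi]. *)
Definition fejer_kernel n w x : R :=
  n%:R^-1 * modulus (\sum_(j < n) (cval w * ce (- x)) ^+ j) ^+ 2.

Lemma fejer_kernel_ge0 n w x : 0 <= fejer_kernel n w x.
Proof. by rewrite mulr_ge0 ?invr_ge0 ?sqr_ge0. Qed.

Lemma fejer_kernelE n w x : ((fejer_kernel n w x)%:C)%C =
  n%:R^-1 * \sum_(j < n) \sum_(l < n)
    cval w ^ (j%:Z - l%:Z) * ce (- ((j%:Z - l%:Z)%:~R * x)).
Proof.
rewrite /fejer_kernel rmorphM fmorphV rmorph_nat rmorphXn /= -normr_modulus.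
rewrite sqr_normc; congr (_ * _); set u := cval w * _.
have u1 : `|u| = 1 by rewrite normrM !norm_cval mulr1.
have u0 : u != 0 by rewrite -normr_gt0 u1.
have uC : (u^*)%C = u^-1.
  by apply: (mulfI u0); rewrite -sqr_normc u1 mulfV// expr1n.
rewrite rmorph_sum mulr_suml; apply: eq_bigr => j _.
rewrite mulr_sumr; apply: eq_bigr => l _.
rewrite rmorphXn/= uC -mulrN circle_exp_intM -expfzMl -/u.
by rewrite expfzDr// -!exprnP exprVn exprnN.
Qed.

(** With [u = w e^(-ix)] the left-hand side is
    [|(u - 1) (1 + u + ... + u^(n-1))|^2 / n = |u^n - 1|^2 / n]. *)
Lemma fejer_kernel_concentrates n w x :
  fejer_kernel n w x * modulus (ce x - cval w) ^+ 2 <= 4 / n%:R.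
Proof.
rewrite /fejer_kernel; set u := cval w * _.
have u1 : modulus u = 1.
  by rewrite Normc.normcM !modulus_cval mulr1.
have -> : modulus (ce x - cval w) = modulus (u - 1).
  rewrite -normcN opprB.
  have -> : u - 1 = (cval w - ce x) * ce (- x).
    by rewrite mulrBl -circle_expD subrr circle_exp0.
  by rewrite Normc.normcM modulus_cval mulr1.
rewrite -mulrA -exprMn -Normc.normcM mulrC (mulrC _ (u - 1)) -subrX1.
rewrite ler_wpM2r ?invr_ge0//.
have -> : 4 = 2 ^+ 2 :> R by rewrite -natrX.
rewrite lerXn2r ?nnegrE ?modulus_ge0//.
apply: (le_trans (modulusD _ _)).
have -> : modulus (u ^+ n) = 1.
  apply: complexI; rewrite -normr_modulus normrX normr_modulus u1.
  by rewrite expr1n.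
by rewrite normcN Normc.normc1.
Qed.

Lemma fejer_kernel_continuous n w : continuous (fejer_kernel n w).
Proof.
have h : ccontinuous (fun x => n%:R^-1 * \sum_(j < n) \sum_(l < n)
    cval w ^ (j%:Z - l%:Z) * ce (- ((j%:Z - l%:Z)%:~R * x))).
  apply: ccontinuousM; first exact: ccontinuous_cst.
  apply: ccontinuous_sum => j; apply: ccontinuous_sum => l.
  apply: ccontinuousM; first exact: ccontinuous_cst.
  under [X in ccontinuous X]funext do rewrite -mulNr.
  exact: ccontinuous_circle_exp.
have [+ _] := h.
by under [X in continuous X]funext do rewrite -fejer_kernelE.
Qed.

Lemma fejer_integral F n w : continuous F ->
  fejer F n w = (((2 * pi)^-1)%:C)%C *
    complex_integral period
      (fun x => ((fejer_kernel n w x)%:C)%C * F (circle_exp x)).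
Proof.
move=> /ccontinuous_comp_circle_exp Fc.
have ec (m : int) :
    ccontinuous (fun x => ce (- (m%:~R * x)) * F (circle_exp x)).
  apply: ccontinuousM => //.
  under [X in ccontinuous X]funext do rewrite -mulNr.
  exact: ccontinuous_circle_exp.
have ewc (m : int) : ccontinuous
    (fun x => cval w ^ m * (ce (- (m%:~R * x)) * F (circle_exp x))).
  by apply: ccontinuousM => //; exact: ccontinuous_cst.
under [X in complex_integral _ X]funext => x.
  rewrite fejer_kernelE -mulrA mulr_suml.
  under eq_bigr => j _ do (rewrite mulr_suml; under eq_bigr do rewrite -mulrA).
  over.
rewrite complex_integralZl; last first.
  by apply: ccontinuous_sum => j; apply: ccontinuous_sum => l; exact: ewc.
rewrite complex_integral_sum; last first.
  by move=> j; apply: ccontinuous_sum => l; exact: ewc.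
rewrite mulrCA; congr (_ * _); rewrite mulr_sumr; apply: eq_bigr => j _.
rewrite complex_integral_sum; last by move=> l; exact: ewc.
rewrite mulr_sumr; apply: eq_bigr => l _.
by rewrite complex_integralZl// mulrCA [RHS]mulrC.
Qed.

Lemma continuous_cst1 : continuous (fun _ : circle R => 1 : R[i]).
Proof. by apply: cst_continuous. Qed.

(** The constant function 1 is its own Fejer mean. *)
Lemma fejer_kernel_integral n w : (0 < n)%N -> J (fejer_kernel n w) = 2 * pi.
Proof.
move=> n0.
have : fejer (fun=> 1) n w = 1.
  rewrite /fejer (eq_bigr (fun=> 1)).
    by rewrite sumr_const card_ord mulVf// pnatr_eq0 -lt0n.
  move=> j _; rewrite (bigD1 j)//= fourier_coef1 subrr eqxx expr0z mulr1.
  rewrite big1 ?addr0// => l lj; rewrite fourier_coef1 subr_eq0 eqz_nat.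
  by rewrite val_eqE eq_sym (negbTE lj) mul0r.
rewrite (fejer_integral _ _ continuous_cst1).
move=> /(congr1 (fun c => complex.Re c)).
rewrite Re_realM Re_complex_integral.
under [X in _ * X = _ -> _]eq_Rintegral do rewrite Re_realM mulr1.
move=> /(congr1 ( *%R (2 * pi))).
by rewrite mulrA mulfV ?gt_eqF ?twopi_gt0// mul1r mulr1.
Qed.

End fejer_kernel.

Section fejer_convergence.
Context {R : realType}.
Implicit Types (F : circle R -> R[i]) (w : circle R).

Local Notation ce x := (cval (circle_exp x)).
Local Notation period := (`[0, 2 * pi]%classic : set R).
Local Notation mu := (@lebesgue_measure R).
Local Notation J u := (Rintegral mu period u).

Lemma continuous_bounded_on_period (u : R -> R) : continuous u ->
  exists M : R, forall x, period x -> `|u x| <= M.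
Proof.
move=> uc.
have [|c _ cmax] :=
  @EVT_max R (fun x => `|u x|) 0 (2 * pi) (ltW twopi_gt0).
  apply: continuous_subspaceT => x.
  by apply: continuous_comp; [exact: uc|exact: norm_continuous].
by exists `|u c| => x /cmax.
Qed.

(** Continuity at [w] gives the bound [e] close to [w]; at distance at least [d]
    from [w], boundedness by some M is absorbed by taking [K = M / d^2]. *)
Lemma modulus_le_parabola F w (e : R) : continuous F -> 0 < e ->
  exists2 K : R, 0 <= K & forall x, period x ->
    modulus (F (circle_exp x) - F w) <= e + K * modulus (ce x - cval w) ^+ 2.
Proof.
move=> Fc e0; have [d d0 Fd] := circle_continuousP (Fc w) e0.
have [Fr Fi] := ccontinuous_comp_circle_exp Fc.
have [M1 FM1] := continuous_bounded_on_period Fr.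
have [M2 FM2] := continuous_bounded_on_period Fi.
pose M := `|M1| + `|M2| + modulus (F w).
have M0 : 0 <= M by rewrite !addr_ge0// modulus_ge0.
have FM x : period x -> modulus (F (circle_exp x) - F w) <= M.
  move=> px; apply: (le_trans (modulusD _ _)); rewrite normcN lerD2r.
  apply: (le_trans (modulus_le_ReIm _)); apply: lerD.
    by apply: (le_trans (FM1 x px)); exact: ler_norm.
  by apply: (le_trans (FM2 x px)); exact: ler_norm.
exists (M / d ^+ 2); first by rewrite divr_ge0// sqr_ge0.
move=> x px; have [xd|dx] := ltP (modulus (ce x - cval w)) d.
  rewrite (le_trans (ltW (Fd _ xd)))// lerDl mulr_ge0 ?sqr_ge0//.
  by rewrite divr_ge0// sqr_ge0.
apply: (le_trans (FM x px)); rewrite -[leLHS]add0r lerD ?(ltW e0)//.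
rewrite mulrAC ler_pdivlMr ?exprn_gt0// ler_wpM2l//.
by rewrite lerXn2r ?nnegrE ?modulus_ge0// ltW.
Qed.

(** The kernel has mass [2 * pi], so the difference is the mean of [G x - G0];
    positivity of the kernel lets the parabolic bound pass to the mean, where
    [fejer_kernel_concentrates] makes its quadratic part small. *)
Lemma fejer_kernel_approx (G : R -> R) (G0 e K : R) w (n : nat) : (0 < n)%N ->
  continuous G -> 0 <= e -> 0 <= K ->
  (forall x, period x -> `|G x - G0| <= e + K * modulus (ce x - cval w) ^+ 2) ->
  `|(2 * pi)^-1 * J (fun x => fejer_kernel n w x * G x) - G0| <=
    e + K * (4 / n%:R).
Proof.
move=> n0 Gc e0 K0 GK.
have kc := @fejer_kernel_continuous R n w.
have kMc (u : R -> R) : continuous u ->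
    continuous (fun x => fejer_kernel n w x * u x).
  by move=> uc x; apply: cvgM; [exact: kc|exact: uc].
have cstc (c : R) : continuous (fun _ : R => c) by move=> x; exact: cvg_cst.
have kint := fejer_kernel_integral w n0.
have twopi0 : 0 < 2 * pi :> R := twopi_gt0.
have Jc (c : R) : J (fun x => fejer_kernel n w x * c) = 2 * pi * c.
  by rewrite RintegralZr ?kint//; exact: period_integrable.
have -> : (2 * pi)^-1 * J (fun x => fejer_kernel n w x * G x) - G0 =
    (2 * pi)^-1 * J (fun x => fejer_kernel n w x * (G x - G0)).
  under [in RHS]eq_Rintegral do rewrite mulrBr.
  rewrite RintegralB//; [|by apply: period_integrable; exact: kMc..].
  by rewrite Jc mulrBr mulKf// gt_eqF.
have Gsub : continuous (fun x => G x - G0).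
  by move=> x; apply: cvgB; [exact: Gc|exact: cvg_cst].
rewrite normrM gtr0_norm ?invr_gt0// ler_pdivrMl//.
have -> : 2 * pi * (e + K * (4 / n%:R)) =
    J (fun x => fejer_kernel n w x * e + K * (4 / n%:R)).
  rewrite RintegralD//; [|by apply: period_integrable; exact: kMc|].
    by rewrite Jc Rintegral_cst// period_measure mulrDr [X in _ = _ + X]mulrC.
  exact: (period_integrable (cstc _)).
apply: le_trans (le_normr_Rintegral _ _) _ => //.
  by apply: period_integrable; exact: kMc.
apply: le_Rintegral => //.
- apply: (@period_integrable _
    (fun x => `|fejer_kernel n w x * (G x - G0)|)) => x.
  apply: (@continuous_comp _ _ _ (fun x => fejer_kernel n w x * (G x - G0))
    (fun y : R => `|y|)); first exact: kMc.
  exact: norm_continuous.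
- apply: (@period_integrable _
    (fun x => fejer_kernel n w x * e + K * (4 / n%:R))) => x.
  by apply: cvgD; [exact: kMc|exact: cvg_cst].
move=> x px; rewrite normrM ger0_norm ?fejer_kernel_ge0//.
apply: (le_trans (ler_wpM2l (fejer_kernel_ge0 n w x) (GK x px))).
rewrite mulrDr lerD2l mulrCA.
exact: (ler_wpM2l K0 (fejer_kernel_concentrates n w x)).
Qed.

Let ReB (x y : R[i]) : complex.Re (x - y) = complex.Re x - complex.Re y.
Proof. by case: x y => ? ? []. Qed.

Let ImB (x y : R[i]) : complex.Im (x - y) = complex.Im x - complex.Im y.
Proof. by case: x y => ? ? []. Qed.

Lemma fejer_cvg F w (e : R) : continuous F -> 0 < e ->
  \forall n \near \oo, modulus (fejer F n w - F w) <= e.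
Proof.
move=> Fc e0; have e40 : 0 < e / 4 by rewrite divr_gt0.
have [K K0 FK] := modulus_le_parabola w Fc e40.
have [Fr Fi] := ccontinuous_comp_circle_exp Fc.
near=> n.
have n0 : (0 < n)%N by near: n; exact: nbhs_infty_gt.
have Kn : K * (4 / n%:R) <= e / 4.
  rewrite mulrA ler_pdivrMr ?ltr0n// [leRHS]mulrC -ler_pdivrMr//.
  by near: n; exact: nbhs_infty_ger.
have bound (G : R -> R) (G0 : R) : continuous G ->
    (forall x, `|G x - G0| <= modulus (F (circle_exp x) - F w)) ->
    `|(2 * pi)^-1 * J (fun x => fejer_kernel n w x * G x) - G0| <= e / 2.
  move=> Gc GF; apply: (le_trans (fejer_kernel_approx n0 Gc (ltW e40) K0 _)).
    by move=> x px; apply: (le_trans (GF x)); exact: FK.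
  by move: Kn; lra.
rewrite fejer_integral//; apply: (le_trans (modulus_le_ReIm _)).
rewrite [leRHS]splitr; apply: lerD.
  apply: le_trans (bound _ (complex.Re (F w)) Fr _).
    rewrite ReB Re_realM Re_complex_integral.
    by under [in leLHS]eq_Rintegral do rewrite Re_realM.
  move=> x; apply: le_trans (le_modulus_Re _) => /=.
  by rewrite ReB.
apply: le_trans (bound _ (complex.Im (F w)) Fi _).
  rewrite ImB Im_realM Im_complex_integral.
  by under [in leLHS]eq_Rintegral do rewrite Im_realM.
move=> x; apply: le_trans (le_modulus_Im _) => /=.
by rewrite ImB.
Unshelve. all: by end_near. Qed.

End fejer_convergence.

(** * Bounds on the averages over roots *)

Section Delta_bound.
Context {R : realType}.
Implicit Types (F : circle R -> R[i]) (y : circle R).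

(** The value at [circle_one] of [Delta k] applied to the Fourier series whose
    coefficients are the moduli of those of [F]. *)
Definition aliased_sum F (k : nat) : \bar R :=
  \esum_(m in [set m : int | (k %| m)%Z]) (modulus (fourier_coef F m))%:E.

Lemma aliased_sum_ge0 F k : (0 <= aliased_sum F k)%E.
Proof. by apply: esum_ge0 => m _; rewrite lee_fin modulus_ge0. Qed.

Lemma Delta_le F (k : nat) y : continuous F ->
  ((modulus (Delta k F y))%:E <= aliased_sum F k)%E.
Proof.
move=> Fc; case: (posnP k) => [->|k0].
  by rewrite /Delta invr0 mul0r Normc.normc0 aliased_sum_ge0.
apply/lee_addgt0Pr => e e0.
have [s [us sk sE DeltaE]] := circle_rootsP y k0.
have [n Fn] : exists n, forall w, w \in s -> modulus (fejer F n w - F w) <= e.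
  have [n _ Hn] : \forall n \near \oo,
      forall w, w \in s -> modulus (fejer F n w - F w) <= e.
    elim: s {us sk sE DeltaE} => [|v s ih]; first by near=> n.
    have := fejer_cvg v Fc e0; apply: filterS2 ih => n sn vn w.
    by rewrite inE => /predU1P[->//|/sn].
  by exists n; apply: Hn => /=.
have -> : Delta k F y = Delta k (fejer F n) y -
    k%:R^-1 * \sum_(w <- s) (fejer F n w - F w).
  by rewrite !DeltaE sumrB mulrBr subKr.
rewrite (le_trans _ (leeD (Delta_fejer_le F n y k0) (lexx e%:E)))//.
rewrite -EFinD lee_fin (le_trans (modulusD _ _))// lerD2l normcN.
rewrite Normc.normcM modulus_natV ler_pdivrMl ?ltr0n//.
apply: (le_trans (modulus_sum _ _ _)).
apply: (@le_trans _ _ (\sum_(w <- s) e)).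
  by rewrite !big_seq; apply: ler_sum => w /Fn.
rewrite big_const_seq count_predT iter_addr_0 -[leLHS]mulr_natl.
by rewrite ler_wpM2r ?ler_nat// ltW.
Unshelve. all: by end_near. Qed.

Import HBNNSimple.

(** The integral of a nonnegative function is a supremum over the simple
    functions below it, each of which lies below the constant [c]. *)
Lemma expectation_le_cst (d : measure_display) (T : measurableType d)
    (P : probability T R) (X : T -> R) (c : \bar R) :
  (forall t, 0 <= X t) -> (forall t, ((X t)%:E <= c)%E) -> ('E_P[X] <= c)%E.
Proof.
move=> X0 Xc; rewrite unlock.
have [->|c_fin] := eqVneq c +oo%E; first exact: leey.
have c0 : (0 <= c)%E by rewrite (le_trans _ (Xc point))// lee_fin.
have cE : c = (fine c)%:E.
  by rewrite fineK// fin_numE c_fin gt_eqF// (lt_le_trans _ c0).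
rewrite ge0_integralTE => [|t]; last by rewrite lee_fin.
apply: ge_ereal_sup => _ [h /= hX <-].
rewrite -integralT_nnsfun.
apply: (@le_trans _ _ (\int[P]_t c)%E).
  apply: ge0_le_integral => //.
  - by move=> t _; rewrite lee_fin; exact: fun_ge0.
  - apply/measurable_EFinP; exact: measurable_funP.
  - by move=> t _; exact: le_trans (hX t) (Xc t).
rewrite cE integral_cst// -[leRHS]mule1 lee_wpmul2l -?cE//.
exact: probability_le1.
Qed.

Lemma expectation_Delta_le F (d : measure_display) (T : measurableType d)
    (P : probability T R) (Y : T -> circle R) (k : nat) :
  continuous F ->
  ('E_P[fun t => modulus (Delta k F (Y t))] <= aliased_sum F k)%E.
Proof.
move=> Fc; apply: expectation_le_cst => t; first exact: modulus_ge0.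
exact: Delta_le.
Qed.

(** On the multiples m = kn of k the power factors as [|k|^(-1-d) |n|^(-1-d)];
    [n = 0] is covered by the vanishing of the mean of [F], and for [k >= M] all
    other multiples of k lie in the range of the hypothesis. *)
Lemma aliased_sum_powR F (d C : R) (M : nat) :
  0 < d -> fourier_coef F 0 = 0 ->
  (forall m : int, (M <= `|m|)%N ->
    modulus (fourier_coef F m) <= C * `|m|%N%:R `^ (- 1 - d)) ->
  exists C' : R, \forall k \near \oo,
    (aliased_sum F k <= (C' * k%:R `^ (- 1 - d))%:E)%E.
Proof.
move=> d0 F0 FC; have [B B0 HB] := esum_int_powR_le d0.
exists (`|C| * B); near=> k.
have k0 : (0 < k)%N by near: k; exact: nbhs_infty_gt.
have Mk : (M <= k)%N by near: k; exact: nbhs_infty_ge.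
rewrite /aliased_sum
  (_ : [set _ | _] = range (fun n : int => n * k%:Z)); last first.
  apply/seteqP; split => [m /dvdzP[n ->]|_ [n _ <-]]/=; first by exists n.
  by rewrite dvdz_mull.
rewrite esum_image; last first.
  by move=> i j _ _; apply: mulIf; rewrite eqz_nat -lt0n.
pose b (n : int) : \bar R :=
  ((`|C| * k%:R `^ (- 1 - d))%:E * (`|n|%N%:R `^ (- 1 - d))%:E)%E.
apply: (@le_trans _ _ (\esum_(n in [set: int]) b n)%E).
  apply: le_esum => n _; rewrite /b -EFinM lee_fin.
  have [->|n0] := eqVneq n 0.
    by rewrite mul0r F0 Normc.normc0 mulr_ge0 ?powR_ge0// mulr_ge0 ?powR_ge0.
  apply: (le_trans (FC _ _)); rewrite abszM absz_nat.
    by rewrite (leq_trans Mk)// leq_pmull// absz_gt0.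
  rewrite natrM powRM// -mulrA (mulrC (k%:R `^ _)).
  rewrite ler_wpM2r ?mulr_ge0 ?powR_ge0//.
  exact: ler_norm.
apply: (le_trans (le_esumZl _ _ _)) => [|n|].
- by rewrite mulr_ge0// powR_ge0.
- by rewrite lee_fin powR_ge0.
by rewrite mulrAC [leRHS]EFinM lee_wpmul2l// lee_fin mulr_ge0 ?powR_ge0.
Unshelve. all: by end_near. Qed.

Lemma divisor_sum_le (eps a : R) : 0 < eps -> 0 <= a ->
  exists2 D : R, 0 <= D & forall (m : int) (n : nat), m != 0 ->
   \sum_(1 <= k < n | (k %| m)%Z) k%:R `^ a <= D * `|m|%N%:R `^ (a + eps).
Proof.
move=> eps0 a0; have [D D0 HD] := divisor_bound eps0; exists D => // m n m0.
have sum_cst (s : seq nat) (c : R) : \sum_(k <- s) c = c * (size s)%:R.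
  by rewrite big_const_seq count_predT iter_addr_0 mulr_natr.
have am0 : (0 < `|m|)%N by rewrite absz_gt0.
apply: (@le_trans _ _ (\sum_(k <- divisors `|m|) `|m|%N%:R `^ a)).
  rewrite -[leLHS]big_filter; set r := [seq k <- _ | _].
  have rm k : k \in r -> (k %| `|m|)%N.
    by rewrite mem_filter dvdzE absz_nat => /andP[].
  have le_term : \sum_(k <- r) k%:R `^ a <= \sum_(k <- r) `|m|%N%:R `^ a.
    rewrite !big_seq; apply: ler_sum => k /rm km.
    by rewrite ge0_ler_powR ?nnegrE ?ler_nat// dvdn_leq.
  apply: (le_trans le_term).
  rewrite !sum_cst ler_wpM2l ?powR_ge0// ler_nat.
  apply: uniq_leq_size; first by rewrite filter_uniq// iota_uniq.
  by move=> k /rm km; rewrite -dvdn_divisors.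
rewrite sum_cst mulrC.
rewrite powRD; last by rewrite pnatr_eq0 -lt0n am0 implybT.
by rewrite mulrCA mulrC ler_wpM2l ?powR_ge0// HD.
Qed.

(** On exchanging the sums, the frequency m receives the weight
    [sum of k^a over the divisors k of m], which is [O(|m|^s)]; the frequency 0,
    which all [k] divide, drops out because its coefficient is 0. *)
Lemma weighted_aliased_sum_lty F (a s : R) :
  0 <= a -> a < s -> fourier_coef F 0 = 0 ->
  (\esum_(m in [set: int])
    (`|m|%N%:R `^ s * modulus (fourier_coef F m))%:E < +oo)%E ->
  (\sum_(1 <= k <oo) ((k%:R `^ a)%:E * aliased_sum F k) < +oo)%E.
Proof.
move=> a0 s_gt F0 Fs.
have eps0 : 0 < s - a by rewrite subr_gt0.
have [D D0 HD] := divisor_sum_le eps0 a0.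
have term0 (k : nat) : (0 <= (k%:R `^ a)%:E * aliased_sum F k)%E.
  by rewrite mule_ge0 ?aliased_sum_ge0// lee_fin powR_ge0.
set W := (\esum_(m in _) _)%E in Fs.
apply: (@le_lt_trans _ _ (D%:E * W)%E); last first.
  by rewrite lte_mul_pinfty// lee_fin.
apply: lime_le; first by apply: is_cvg_nneseries => k _ _; exact: term0.
near=> n.
pose t (m : int) (k : nat) : \bar R :=
  if (k %| m)%Z then (k%:R `^ a * modulus (fourier_coef F m))%:E else 0%E.
have t0 m k : (0 <= t m k)%E.
  rewrite /t; case: ifP => // _.
  by rewrite lee_fin mulr_ge0 ?powR_ge0 ?modulus_ge0.
apply: (@le_trans _ _ (\sum_(1 <= k < n) \esum_(m in [set: int]) t m k)%E).
  apply: lee_sum => k _; rewrite /aliased_sum -esumZl ?powR_ge0//; last first.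
    by move=> m; rewrite lee_fin modulus_ge0.
  rewrite esum_mkcond; apply: le_esum => m _; rewrite /t.
  have [/set_mem/= ->//|] := boolP (_ \in _).
  by rewrite notin_setE/= => /negP/negbTE ->.
rewrite -esum_sum; last by move=> m k _ _; exact: t0.
apply: (@le_trans _ _ (\esum_(m in [set: int])
    (D%:E * (`|m|%N%:R `^ s * modulus (fourier_coef F m))%:E))%E); last first.
  apply: le_esumZl => // m.
  by rewrite lee_fin mulr_ge0 ?powR_ge0 ?modulus_ge0.
apply: le_esum => m _.
have [->|m0] := eqVneq m 0.
  rewrite F0 Normc.normc0 mulr0 mule0 big1// => k _.
  by rewrite /t F0 Normc.normc0 mulr0 if_same.
have -> : (\sum_(1 <= k < n) t m k =
    ((\sum_(1 <= k < n | (k %| m)%Z) k%:R `^ a) *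
      modulus (fourier_coef F m))%:E)%E.
  rewrite mulr_suml -sumEFin [RHS]big_mkcond.
  by apply: eq_bigr => k _.
rewrite -EFinM lee_fin mulrA ler_wpM2r ?modulus_ge0//.
by rewrite (le_trans (HD m n m0))// addrC subrK.
Unshelve. all: by end_near. Qed.

End Delta_bound.

Theorem theorem5p6 (R : realType) (F : circle R -> R[i])
    (d : measure_display) (T : measurableType d) (P : probability T R)
    (z : nat -> {RV P >-> circle R})
    (d' : measure_display) (T' : measurableType d') (Q : probability T' R)
    (Z : nat -> {RV Q >-> circle R})
    (theta : R) :
  continuous F ->
  fourier_coef F 0 = 0 ->
  (* z j stands for z_(j+1) *)
  iid P (fun j => z j : T -> circle R) ->
  (* Z k stands for Z_(k,1) *)
  (forall k : nat, (0 < k)%N ->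
    eq_in_law Q P (Z k)
      (fun t => \big[circle_mul/circle_one]_(j < k) z j t)) ->
  0 <= theta ->
  (forall delta : R, 0 < delta <= 1 ->
    (exists (C : R) (M : nat), forall m : int, (M <= `|m|)%N ->
      modulus (fourier_coef F m) <= C * `|m|%N%:R `^ (- 1 - delta)) ->
    exists C : R, \forall k \near \oo,
      ('E_Q[fun t => modulus (Delta k F (Z k t))]
        <= (C * k%:R `^ (- 1 - delta))%:E)%E)
  /\
  ((exists s : R, Num.max (1 - theta) 0 < s /\
      (\esum_(m in [set: int])
         (`|m|%N%:R `^ s * modulus (fourier_coef F m))%:E < +oo)%E) ->
    (\sum_(1 <= k <oo)
       ((k%:R `^ Num.max (1 - theta) 0)%:E
         * 'E_Q[fun t => modulus (Delta k F (Z k t))]) < +oo)%E).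
Proof.
move=> Fc F0 _ _ _; split.
- move=> delta /andP[delta0 _] [C [M FC]].
  have [C' FC'] := aliased_sum_powR delta0 F0 FC.
  exists C'; near=> k.
  apply: le_trans (expectation_Delta_le _ _ _ Fc) _.
  by near: k; exact: FC'.
- move=> [s [s_gt Fs]].
  have a0 : 0 <= Num.max (1 - theta) 0 by rewrite le_max lexx orbT.
  apply: le_lt_trans (weighted_aliased_sum_lty a0 s_gt F0 Fs).
  apply: lee_nneseries => k.
    move=> _ _; rewrite mule_ge0 ?lee_fin ?powR_ge0//.
    by apply: expectation_ge0 => t; exact: modulus_ge0.
  move=> _; rewrite lee_wpmul2l ?lee_fin ?powR_ge0//.
  exact: expectation_Delta_le.
Unshelve. all: by end_near. Qed.
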